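(* Let $\Omega\subset\mathbb{R}^n$ be a sharp convex domain and let $\gamma:[0,1]\to\Omega$ be a path. Then $\gamma$ is a geodesic for the Hilbert metric $H_\Omega$ in $\Omega$ if and only if there exist two faces $D^-,D^+\subset\tilde\partial\Omega$ such that for any $t_1<t_2$ in $[0,1]$ we have $\gamma(t_2)-\gamma(t_1)\in C_{\gamma(t_1)}(D^+)$ and $\gamma(t_1)-\gamma(t_2)\in C_{\gamma(t_2)}(D^-)$.
   Context: A sharp convex domain in $\mathbb{R}^n$ is a non-empty open convex subset $\Omega\neq\mathbb{R}^n$ containing no affine line. View $\mathbb{R}^n$ as an affine space in $\mathbb{RP}^n$ with hyperplane at infinity $H_\infty=\mathbb{RP}^n\setminus\mathbb{R}^n$; $\overline\Omega$ is the closure of $\Omega$ in $\mathbb{R}^n$, $\widetilde\Omega$ its closure in $\mathbb{RP}^n$, and $\tilde\partial\Omega=\widetilde\Omega\setminus\Omega$. For $p\ne q$ let $R(p,q)=\{p+t(q-p):t\ge0\}$ and let $\overline R(p,q)$ be the extended ray, i.e. the closure of $R(p,q)$ in $\mathbb{RP}^n$. For $x\neq y$ in $\Omega$, $a_\Omega(x,y)$ is the intersection of the extended ray $\overline R(x,y)$ with $\tilde\partial\Omega$, understood as a single point: the point of $R(x,y)\cap\partial\Omega$ if $R(x,y)\not\subset\Omega$, and the point at infinity of $R(x,y)$ if $R(x,y)\subset\Omega$. The Funk metric is $F_\Omega(x,x)=0$ and, for $x\ne y$ and $a=a_\Omega(x,y)$, $F_\Omega(x,y)=\log\frac{|x-a|}{|y-a|}$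 if $a\notin H_\infty$ and $F_\Omega(x,y)=0$ if $a\in H_\infty$. The Hilbert metric is $H_\Omega(x,y)=\frac12(F_\Omega(x,y)+F_\Omega(y,x))$. A path is a continuous map from an interval. A path $\gamma:[a,b]\to\Omega$ is a geodesic for $H_\Omega$ if $H_\Omega(\gamma(a),\gamma(b))$ equals its length $\sup\sum_{i=0}^{N-1}H_\Omega(\gamma(t_i),\gamma(t_{i+1}))$, the supremum being over all subdivisions $a=t_0<\dots<t_N=b$. A convex subset $D\subset\overline\Omega$ is a face of $\overline\Omega$ if for any $x,y\in\overline\Omega$ and any $0<\lambda<1$, $(1-\lambda)x+\lambda y\in D$ implies $[x,y]\subset D$; the same notion, with $\widetilde\Omega$ in place of $\overline\Omega$, is used for faces $D\subset\tilde\partial\Omega$. For $p\in\Omega$, $C_p(D)=\{v\in\mathbb{R}^n : v=0 \text{ or } \overline R(p,p+v)\cap D\neq\emptyset\}$; this is a cone at the origin, and $p+C_p(D)$ is the cone over $D$ with vertex $p$.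
   Formalization: In the cone C_p(D), the extended ray from p with direction v is taken to meet the projective boundary only at the single point a_Ω(p,p+v); with the closure of the ray in RP^n the claim fails for Ω=(0,∞), D⁺=D⁻={∞}. *)

(* Defs.v *)
From HB Require Import structures.
From mathcomp Require Import all_boot all_order all_algebra.
From mathcomp Require Import all_classical all_reals all_analysis.
Set Implicit Arguments.
Unset Strict Implicit.
Unset Printing Implicit Defensive.
Import Order.TTheory GRing.Theory Num.Theory.
Import numFieldNormedType.Exports.
Local Open Scope classical_set_scope.
Local Open Scope ring_scope.

Section ProjectiveSpace.
Local Open Scope quotient_scope.
Variables (R : realType) (n : nat).

Definition nonzero_vectors : set 'rV[R]_(1 + n) := [set v | v != 0].

Definition proportional (u v : nonzero_vectors) : bool :=
  `[< exists2 c : R, c != 0 & val u = c *: val v >].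

Lemma proportional_refl : reflexive proportional.
Proof. by move=> u; apply/asboolP; exists 1; rewrite ?oner_neq0 ?scale1r. Qed.

Lemma proportional_sym : symmetric proportional.
Proof.
suff H u v : proportional u v -> proportional v u by move=> u v; apply/idP/idP; exact: H.
move=> /asboolP[c c0 e]; apply/asboolP; exists c^-1; first by rewrite invr_neq0.
by rewrite e scalerA mulVf// scale1r.
Qed.

Lemma proportional_trans : transitive proportional.
Proof.
move=> v u w /asboolP[c c0 e] /asboolP[d d0 f]; apply/asboolP.
by exists (c * d); rewrite ?mulf_neq0// e f scalerA.
Qed.

Canonical proportional_equiv :=
  EquivRel proportional proportional_refl proportional_sym proportional_trans.

(* RP^n = (R^(1+n) \ {0}) / R^*, with the quotient topology. *)
Definition projective_space : topologicalType :=
  quotient_topology {eq_quot proportional_equiv}.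

Lemma e0_nonzero : (row_mx 1 0 : 'rV[R]_(1 + n)) \in nonzero_vectors.
Proof.
rewrite inE /nonzero_vectors/= -row_mx0; apply/eqP => /eq_row_mx[/eqP].
by rewrite oner_eq0.
Qed.

(* [proj v] is the point [v] of RP^n for v != 0; [proj 0] is a junk value. *)
Definition proj (v : 'rV[R]_(1 + n)) : projective_space :=
  \pi_({eq_quot proportional_equiv})
    (insubd (exist _ (row_mx 1 0) e0_nonzero : nonzero_vectors) v).

Definition affine_point (x : 'rV[R]_n) : projective_space := proj (row_mx 1 x).

Definition point_at_infinity (v : 'rV[R]_n) : projective_space :=
  proj (row_mx 0 v).

Definition hyperplane_at_infinity : set projective_space :=
  ~` range affine_point.

(* The vector x with [affine_point x = a] (0 if [a] lies at infinity). *)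
Definition affine_coord (a : projective_space) : 'rV[R]_n :=
  xget 0 [set x | affine_point x = a].

End ProjectiveSpace.

Section FunkHilbert.
Variables (R : realType) (n : nat).
Local Notation V := ('rV[R]_n).
Local Notation RP := (projective_space R n).
Implicit Types (Om : set V) (x y p v : V).

Definition contains_line Om : Prop :=
  exists p v, v != 0 /\ forall t : R, Om (p + t *: v).

Definition sharp_convex_domain Om : Prop :=
  [/\ Om !=set0, open Om, convex_set Om, Om <> setT & ~ contains_line Om].

(* The default norm of 'rV is the sup norm; |.| is the Euclidean one. *)
Definition euclidean_norm v : R := Num.sqrt (\sum_(i < n) v 0 i ^+ 2).

Definition ray p q : set V := [set p + t *: (q - p) | t in [set t | 0 <= t]].

Definition proj_closure Om : set RP := closure (@affine_point R n @` Om).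

Definition proj_boundary Om : set RP :=
  proj_closure Om `\` (@affine_point R n @` Om).

(* a_Om(x, y), the point where the extended ray from x (in Om) through y
   (y != x, not necessarily in Om) leaves Om.  [boundary_hit] is well defined
   because an open convex set has a single boundary point on a ray that starts
   in it and is not contained in it. *)
Definition boundary_hit Om x y : V :=
  xget 0 (ray x y `&` (closure Om `\` Om)).

Definition ray_end Om x y : RP :=
  if `[< ray x y `<=` Om >] then point_at_infinity (y - x)
  else affine_point (boundary_hit Om x y).

Definition funk Om x y : R :=
  let a := ray_end Om x y in
  if (x == y) || `[< hyperplane_at_infinity a >] then 0
  else ln (euclidean_norm (x - affine_coord a) /
           euclidean_norm (y - affine_coord a)).

Definition hilbert Om x y : R := 2^-1 * (funk Om x y + funk Om y x).

Definition path_in Om (a b : R) (g : R -> V) : Prop :=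
  {within `[a, b], continuous g} /\ forall t, t \in `[a, b] -> Om (g t).

(* A subdivision a = t_0 < ... < t_N = b is given by s = [:: t_1; ...; t_N]. *)
Definition hilbert_sum Om (a b : R) (g : R -> V) (s : seq R) : R :=
  let t := nth b (a :: s) in
  \sum_(0 <= i < size s) hilbert Om (g (t i)) (g (t i.+1)).

Definition hilbert_length Om (a b : R) (g : R -> V) : \bar R :=
  ereal_sup [set (hilbert_sum Om a b g s)%:E | s in itv_partition a b].

Definition hilbert_geodesic Om (a b : R) (g : R -> V) : Prop :=
  (hilbert Om (g a) (g b))%:E = hilbert_length Om a b g.

(* When Om is sharp, [proj_closure Om] is the projectivization of the closed
   salient cone K = [closed_cone Om], and the segment [x, y] of
   [proj_closure Om] is the image of the segment between lifts of x and y to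
   K \ {0}; it does not depend on the lifts, which are unique up to a positive
   factor.  On affine points this is the usual segment; if x is affine and y
   is the point at infinity of a ray from x in the closure of Om, it is that
   extended ray.  *)
Definition closed_cone Om : set 'rV[R]_(1 + n) :=
  closure [set s *: row_mx 1 x | s in [set s : R | 0 < s] & x in Om].

Definition lift Om (x : RP) : set 'rV[R]_(1 + n) :=
  [set u | [/\ closed_cone Om u, u != 0 & proj u = x]].

Definition proj_segment Om (x y : RP) : set RP :=
  [set z | exists (u v : 'rV[R]_(1 + n)) (t : R), [/\ lift Om x u, lift Om y v, 0 <= t <= 1
    & z = proj ((1 - t) *: u + t *: v)]].

Definition proj_open_segment Om (x y : RP) : set RP :=
  [set z | exists (u v : 'rV[R]_(1 + n)) (t : R), [/\ lift Om x u, lift Om y v, 0 < t < 1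
    & z = proj ((1 - t) *: u + t *: v)]].

Definition proj_convex Om (D : set RP) : Prop :=
  forall x y : RP, D x -> D y -> proj_segment Om x y `<=` D.

Definition proj_face Om (D : set RP) : Prop :=
  [/\ D `<=` proj_closure Om,
      proj_convex Om D
    & forall x y : RP, proj_closure Om x -> proj_closure Om y ->
      proj_open_segment Om x y `&` D !=set0 -> proj_segment Om x y `<=` D].

(* C_p(D), for p in Om and D included in [proj_boundary Om].  The extended ray
   from p with direction v is taken to meet the boundary of Om in RP^n at
   the single point a_Om(p, p + v), so it meets D iff that point is in D.
   Indeed v and - v have the same point at infinity in RP^n: if the
   direction - v stays in Om and v does not, then the closure of the ray of
   direction v in RP^n also contains the point at infinity of - v, which must
   not count as an intersection (with D that single point, C_p(D) would be a
   whole line instead of a half-line). *)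
Definition cone_over Om p (D : set RP) : set V :=
  [set v | v = 0 \/ D (ray_end Om p (p + v))].

End FunkHilbert.

(* Main.v *)
Require Import Defs.
From mathcomp Require Import all_boot all_order all_algebra.
From mathcomp Require Import all_classical all_reals all_analysis.
From mathcomp Require Import ring lra.
Set Implicit Arguments.
Unset Strict Implicit.
Unset Printing Implicit Defensive.
Import Order.TTheory GRing.Theory Num.Theory.
Import numFieldNormedType.Exports.
Local Open Scope classical_set_scope.
Local Open Scope ring_scope.

(** Let [K] be the closed cone over [Om] in R^(1+n), [C] the open cone, and let
    [hom x = (1, x)].  For [x], [y] in [Om], exp (- F(x, y)) is the largest [m]
    such that [hom y - m hom x] lies in [K] ([exit_scale_max], [exit_scale_min]),
    and for [x != y] the vector A(x, y) = [hom y - m hom x] is a lift to [K] of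
    the point where the extended ray from [x] through [y] leaves [Om]
    ([exit_vecP]).  This covers rays that stay in [Om]: then [m = 1].

    Since A(y, z) + m(y, z) A(x, y) = hom z - m(x, y) m(y, z) hom x, the triangle
    inequality F(x, z) <= F(x, y) + F(y, z) holds, and it is an equality exactly
    when this sum, which lies in [K], is not in [C]; the sum is then A(x, z).

    If faces as in the statement exist, the sum is, up to a factor, a convex
    combination of lifts of two points of a face contained in the boundary, so
    it is not in [C]: F is additive along the path and along the reversed path
    ([face_funk_additive]), hence so is the Hilbert metric, and all subdivisions
    give the same sum ([hilbert_geodesicP]).

    Conversely, along a geodesic F is additive in both directions, so that
    A(g 0, g 1) is the sum of a positive multiple of A(g s, g t) and of a vector
    of [K] ([face_of_ray_end]).  Hence all exit points in the positive direction
    lie in the face generated by A(g 0, g 1), which is contained in the boundary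
    because A(g 0, g 1) is not in [C] ([face_of_face], [face_of_boundary]).  The
    other face is generated by A(g 1, g 0).  If [g 0 = g 1] both faces are
    empty, and the path is constant. *)

(* [proj] also names the coordinates of a product space. *)
Local Notation proj := Defs.proj.

(** * Points of projective space *)

Lemma projP {R : realType} {n : nat} (u v : 'rV[R]_(1 + n)) :
  u != 0 -> v != 0 ->
  proj u = proj v <-> exists2 c : R, c != 0 & u = c *: v.
Proof.
move=> u0 v0; rewrite /proj.
have val_insubd w : w != 0 ->
    val (insubd (exist _ (row_mx 1 0) (e0_nonzero R n) : @nonzero_vectors R n) w) = w.
  by move=> w0; rewrite insubdK// inE.
split=> [/(@eqmodP _ (proportional_equiv R n))|[c c0 uE]].
  by rewrite /= => /asboolP[c c0]; rewrite !val_insubd//; exists c.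
apply/(@eqmodP _ (proportional_equiv R n)) => /=.
by apply/asboolP; exists c => //; rewrite !val_insubd.
Qed.

Lemma proj_scale {R : realType} {n : nat} (c : R) (u : 'rV[R]_(1 + n)) :
  c != 0 -> u != 0 -> proj (c *: u) = proj u.
Proof. by move=> c0 u0; apply/projP; rewrite ?scaler_eq0 ?negb_or ?c0//; exists c. Qed.

Lemma row_mx1_neq0 {R : realType} {n : nat} (x : 'rV[R]_n) :
  row_mx (1 : 'M[R]_1) x != 0.
Proof. by rewrite -row_mx0; apply/eqP => /eq_row_mx[/eqP]; rewrite oner_eq0. Qed.

Lemma row_mx0_eq0 {R : realType} {n : nat} (x : 'rV[R]_n) :
  (row_mx (0 : 'M[R]_1) x == 0) = (x == 0).
Proof.
rewrite -(row_mx0 R 1 1 n); apply/eqP/eqP => [/eq_row_mx[]//|->//].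
Qed.

Lemma affine_point_inj {R : realType} {n : nat} :
  injective (@affine_point R n).
Proof.
move=> x y /projP[||c _]; rewrite ?row_mx1_neq0// scale_row_mx.
move=> /eq_row_mx[/matrixP/(_ 0 0)]; rewrite !mxE/= mulr1 => <-.
by rewrite scale1r.
Qed.

Lemma affine_coordK {R : realType} {n : nat} (x : 'rV[R]_n) :
  affine_coord (affine_point x) = x.
Proof.
rewrite /affine_coord; apply: xget_unique => // y; exact: affine_point_inj.
Qed.

Lemma point_at_infinityP {R : realType} {n : nat} (v : 'rV[R]_n) : v != 0 ->
  hyperplane_at_infinity (point_at_infinity v).
Proof.
move=> v0 [x _] /projP[||c c0]; rewrite ?row_mx1_neq0 ?row_mx0_eq0//.
rewrite scale_row_mx => /eq_row_mx[/matrixP/(_ 0 0)]; rewrite !mxE/= mulr0.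
by move/eqP; rewrite oner_eq0.
Qed.

(** The projection is continuous away from 0. *)
Lemma proj_closure_of {R : realType} {n : nat} (A : set 'rV[R]_(1 + n)) u :
  u != 0 -> A `<=` [set w | w != 0] ->
  closure A u -> closure (@Defs.proj R n @` A) (proj u).
Proof.
move=> u0 A0 clAu B; rewrite nbhsE => -[B' [oB' B'u] B'B].
have [U oU UE] : open (\pi_(projective_space R n)%qT @^-1` B') by exact: oB'.
have Uproj w (w0 : w != 0) : U w <-> B' (proj w).
  have wn : w \in @nonzero_vectors R n by rewrite inE.
  have -> : proj w = (\pi_(projective_space R n) (exist _ w wn : @nonzero_vectors R n))%qT.
    by rewrite /proj; congr (\pi_ _)%qT; apply/val_inj; rewrite insubdK.
  by rewrite -[B' _]/((\pi_(projective_space R n)%qT @^-1` B') _) -UE.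
have [|w [Aw Uw]] := clAu U.
  by apply: open_nbhs_nbhs; split => //; apply/Uproj.
by exists (proj w); split; [exists w|apply: B'B; apply/Uproj => //; exact: A0].
Qed.

(** * Arithmetic of additive chains *)

(** The first three facts are applied to values of the Funk metric; the half-sums
    are values of the Hilbert metric. *)

Lemma chain_additive {R : realType} (a b c p q : R) :
  p <= a + b -> q <= p + c -> q = a + b + c -> p = a + b /\ q = p + c.
Proof. by move=> *; split; lra. Qed.

Lemma halves_additive {R : realType} (a b c p a' b' c' p' : R) :
  p <= a + b + c -> p' <= c' + b' + a' ->
  2^-1 * (a + a') + 2^-1 * (b + b') + 2^-1 * (c + c') <= 2^-1 * (p + p') ->
  p = a + b + c /\ p' = c' + b' + a'.
Proof. by move=> *; split; lra. Qed.

Lemma halves_sum {R : realType} (a b p a' b' p' : R) :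
  p = a + b -> p' = b' + a' ->
  2^-1 * (p + p') = 2^-1 * (a + a') + 2^-1 * (b + b').
Proof. by move=> -> ->; ring. Qed.

Lemma invD_compl {R : realType} (m : R) : 0 < 1 + m ->
  (1 + m)^-1 = 1 - m / (1 + m).
Proof. by move=> m1; field; rewrite gt_eqF. Qed.

(** * The cone over a sharp convex domain *)

Section Cone.
Variables (R : realType) (n : nat) (Om : set 'rV[R]_n).
Hypothesis sOm : sharp_convex_domain Om.
Implicit Types (x y p : 'rV[R]_n) (u v w k c : 'rV[R]_(1 + n)).

(** The lift of an affine point in the hyperplane of first coordinate 1. *)
Definition hom x : 'rV[R]_(1 + n) := row_mx 1 x.

(** The open convex cone over [Om]; its closure is [closed_cone Om]. *)
Definition open_cone : set 'rV[R]_(1 + n) :=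
  [set s *: hom x | s in [set s : R | 0 < s] & x in Om].

Local Notation C := open_cone.
Local Notation K := (closed_cone Om).

Lemma domain_convex x y (t : R) : Om x -> Om y -> 0 <= t <= 1 ->
  Om (t *: x + (1 - t) *: y).
Proof.
move=> Ox Oy t01; have [_ _ cOm _ _] := sOm.
have t01' : Itv.spec (@Itv.num_sem R) (Itv.Real `[0%Z, 1%Z]) t.
  by rewrite /= /Itv.num_sem/= num_real in_itv/=.
have := cOm x y (Itv.mk t01'); rewrite !inE => /(_ Ox Oy).
by rewrite /conv/=.
Qed.

Lemma open_coneP w :
  C w <-> 0 < lsubmx w 0 0 /\ Om ((lsubmx w 0 0)^-1 *: rsubmx w).
Proof.
split=> [[s /= s0 [x Ox <-]]|[w0 Ow]].
  rewrite /hom scale_row_mx row_mxKl row_mxKr !mxE/= mulr1 scalerA mulVf ?gt_eqF//.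
  by rewrite scale1r.
exists (lsubmx w 0 0) => //; exists ((lsubmx w 0 0)^-1 *: rsubmx w) => //.
rewrite /hom scale_row_mx scalerA mulfV ?gt_eqF// scale1r.
rewrite -[RHS](@hsubmxK _ _ 1 n); congr row_mx.
by apply/matrixP => i j; rewrite !ord1 !mxE/= mulr1.
Qed.

Lemma open_cone_hom x : C (hom x) <-> Om x.
Proof.
by rewrite open_coneP /hom row_mxKl row_mxKr !mxE/= invr1 scale1r; split=> [[]|].
Qed.

Lemma open_cone_neq0 w : C w -> w != 0.
Proof.
move=> [s /= s0 [x _ <-]].
by rewrite scaler_eq0 negb_or gt_eqF//= row_mx1_neq0.
Qed.

Lemma open_coneZ (s : R) w : 0 < s -> C w -> C (s *: w).
Proof.
move=> s0 [t /= t0 [x Ox <-]]; exists (s * t); first exact: mulr_gt0.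
by exists x; rewrite ?scalerA.
Qed.

Lemma open_coneD u v : C u -> C v -> C (u + v).
Proof.
move=> [s /= s0 [x Ox <-]] [t /= t0 [y Oy <-]].
have st0 : 0 < s + t by rewrite addr_gt0.
exists (s + t) => //; exists ((s / (s + t)) *: x + (1 - s / (s + t)) *: y).
  apply: domain_convex => //; apply/andP; split; first by rewrite divr_ge0 ?ltW.
  by rewrite ler_pdivrMr// mul1r lerDl ltW.
rewrite /hom !scale_row_mx add_row_mx; congr row_mx; first by rewrite scalerDl.
rewrite scalerDr !scalerA mulrBr mulr1 mulrCA mulfV ?gt_eqF// mulr1.
by rewrite addrAC subrr add0r.
Qed.

Lemma open_cone_open : open C.
Proof.
have [_ oOm _ _ _] := sOm.
rewrite openE => w /open_coneP[w0 Ow].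
have cl : (fun u : 'rV[R]_(1 + n) => lsubmx u 0 0) @ w --> lsubmx w 0 0.
  exact: (continuous_comp (@continuous_lsubmx _ 1 1 n w)
            (@coord_continuous _ _ _ _ _ _)).
have cr : (fun u : 'rV[R]_(1 + n) => (lsubmx u 0 0)^-1 *: rsubmx u) @ w -->
    (lsubmx w 0 0)^-1 *: rsubmx w.
  have w0' : lsubmx w 0 0 != 0 by rewrite gt_eqF.
  exact: (cvgZ (cvgV w0' cl) (@continuous_rsubmx _ 1 1 n w)).
have A1 : \forall u \near w, 0 < lsubmx u 0 0.
  exact: (cl _ (lt_nbhsr w0)).
have A2 : \forall u \near w, Om ((lsubmx u 0 0)^-1 *: rsubmx u).
  exact: (cr _ (open_nbhs_nbhs (conj oOm Ow))).
by rewrite /interior; near=> u; apply/open_coneP; split; near: u.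
Unshelve. all: by end_near. Qed.

Lemma open_cone_nonempty : C !=set0.
Proof. by have [[x Ox] _ _ _ _] := sOm; exists (hom x); apply/open_cone_hom. Qed.

Lemma closed_cone_approx c k :
  (forall e : R, 0 < e -> C (e *: c + k)) -> K k.
Proof.
move=> H.
have e0 : (fun e : R => e) @ 0^'+ --> (0 : R).
  exact (cvg_at_right_filter cvg_id).
have ct : (fun e : R => e *: c + k) @ 0^'+ --> 0 *: c + k.
  exact (cvgD (cvgZr_tmp (a := c) e0) (cvg_cst k)).
rewrite scale0r add0r in ct.
move=> B kB; have /ct := kB.
move=> Be; near (0 : R)^'+ => e; exists (e *: c + k); split; first exact: H.
by near: e.
Unshelve. all: by end_near. Qed.

(** The closed cone consists of the translations that preserve the open cone;
    its algebraic properties are read off this description. *)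
Lemma closed_coneP k : K k <-> forall c, C c -> C (c + k).
Proof.
split=> [Kk c Cc|H].
  (* c + k = (c + (k - k')) + k' with k' in the open cone close to k *)
  have : \forall k' \near k, C (c + (k - k')).
    have ct : (fun k' : 'rV[R]_(1 + n) => c + (k - k')) @ k --> c + (k - k).
      pose F : set_system 'rV[R]_(1 + n) := nbhs k.
      have FF : Filter F by exact: nbhs_filter.
      exact: (@cvgD _ _ _ F FF _ _ _ _ (cvg_cst c) (cvgB (cvg_cst k) cvg_id)).
    apply: (ct C); apply: open_nbhs_nbhs; split; first exact: open_cone_open.
    by rewrite subrr addr0.
  move=> /Kk[k' [Ck' /(open_coneD Ck')]].
  by rewrite addrC -addrA subrK.
have [c Cc] := open_cone_nonempty.
apply: (closed_cone_approx (c := c)) => e e0.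
by apply: H; apply: open_coneZ.
Qed.

Lemma open_closed_coneD c k : C c -> K k -> C (c + k).
Proof. by move=> Cc /closed_coneP; apply. Qed.

Lemma open_cone_closed c : C c -> K c.
Proof. by move=> Cc; apply/closed_coneP => c' Cc'; exact: open_coneD. Qed.

Lemma closed_cone0 : K 0.
Proof. by apply/closed_coneP => c; rewrite addr0. Qed.

Lemma closed_coneD u v : K u -> K v -> K (u + v).
Proof.
move=> Ku Kv; apply/closed_coneP => c Cc; rewrite addrA.
by do 2!apply: open_closed_coneD => //.
Qed.

Lemma closed_coneZ (s : R) u : 0 <= s -> K u -> K (s *: u).
Proof.
rewrite le_eqVlt => /predU1P[<- _|s0 Ku]; first by rewrite scale0r; exact: closed_cone0.
apply/closed_coneP => c Cc.
have -> : c + s *: u = s *: (s^-1 *: c + u).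
  by rewrite scalerDr scalerA mulfV ?gt_eqF// scale1r.
apply: open_coneZ => //; apply: open_closed_coneD => //.
by apply: open_coneZ => //; rewrite invr_gt0.
Qed.

Lemma closed_cone_hom_closure x : closure Om x -> K (hom x).
Proof.
move=> clx B /nbhs_ballP[e /= e0 eB].
have [|y [Oy [_ By]]] := clx (ball x e); first exact: nbhsx_ballx.
exists (hom y); split; first exact/open_cone_hom.
apply: eB; split=> // i j; rewrite /hom !mxE.
by case: (fintype.split j) => k; [exact: ballxx|exact: By].
Qed.

Lemma closed_cone_fst_ge0 k : K k -> 0 <= lsubmx k 0 0.
Proof.
move=> Kk; have [c Cc] := open_cone_nonempty.
have [c0 _] := (open_coneP c).1 Cc.
rewrite leNgt; apply/negP => k0.
have e0 : 0 < (- lsubmx k 0 0) / lsubmx c 0 0 by rewrite divr_gt0// oppr_gt0.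
have [] := (open_coneP _).1 (open_closed_coneD (open_coneZ e0 Cc) Kk).
rewrite !linearD !linearZ/= mxE mxE.
by rewrite divfK ?gt_eqF// addNr ltxx.
Qed.

Lemma closed_cone_ray (v : 'rV[R]_n) p : K (row_mx 0 v) -> Om p -> Om (p + v).
Proof.
move=> Kv /open_cone_hom/open_closed_coneD/(_ Kv).
by rewrite /hom add_row_mx addr0 => /open_cone_hom.
Qed.

(** If [u] and [- u] lie in the closed cone, [u] is a direction at infinity, and
    the domain contains every line of direction [u] through its points. *)
Lemma closed_cone_salient u : K u -> K (- u) -> u = 0.
Proof.
move=> Ku KNu; have [[p Op] _ _ _ nl] := sOm.
have uE : u = row_mx 0 (rsubmx u).
  rewrite -[LHS](@hsubmxK _ _ 1 n); congr row_mx.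
  apply/matrixP => i j; rewrite !ord1 [RHS]mxE; apply/eqP.
  rewrite eq_le closed_cone_fst_ge0// andbT.
  by have := closed_cone_fst_ge0 KNu; rewrite linearN/= mxE oppr_ge0.
apply/eqP; apply: contra_notT nl => u0.
exists p, (rsubmx u); split; first by rewrite -row_mx0_eq0 -uE.
move=> t; apply: (closed_cone_ray _ Op).
have -> : row_mx 0 (t *: rsubmx u) = t *: u by rewrite [in RHS]uE scale_row_mx scaler0.
have [t0|/ltW t0] := leP 0 t; first exact: closed_coneZ.
by rewrite -[t]opprK scaleNr -scalerN; apply: closed_coneZ; rewrite ?oppr_ge0.
Qed.

Lemma closed_coneD_eq0 u v : K u -> K v -> u + v = 0 -> u = 0.
Proof.
move=> Ku Kv /eqP; rewrite addr_eq0 => /eqP uE.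
by apply: closed_cone_salient; rewrite // uE opprK.
Qed.

Lemma closed_coneZ_gt0 (s : R) u : u != 0 -> K u -> K (s *: u) -> s *: u != 0 -> 0 < s.
Proof.
move=> u0 Ku Ksu su0; rewrite ltNge; apply/negP => s0.
have : s *: u = 0.
  apply: (closed_cone_salient Ksu); rewrite -scaleNr.
  by apply: (closed_coneZ _ Ku); rewrite oppr_ge0.
exact/eqP.
Qed.

(** * Exit points of rays *)

Lemma euclidean_normZ (a : R) (x : 'rV[R]_n) :
  euclidean_norm (a *: x) = `|a| * euclidean_norm x.
Proof.
rewrite /euclidean_norm -sqrtr_sqr -sqrtrM ?sqr_ge0// mulr_sumr.
by congr (Num.sqrt _); apply: eq_bigr => i _; rewrite mxE exprMn.
Qed.

Lemma euclidean_norm_gt0 x : x != 0 -> 0 < euclidean_norm x.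
Proof.
move=> x0; rewrite sqrtr_gt0 lt_neqAle sumr_ge0 ?andbT => [|i _]; last exact: sqr_ge0.
apply: contra x0; rewrite eq_sym => /eqP /psumr_eq0P H.
apply/eqP/rowP => i; rewrite mxE; apply/eqP; rewrite -sqrf_eq0; apply/eqP.
by apply: H => // j _; exact: sqr_ge0.
Qed.

(** A ray from a point of [Om] that is not contained in [Om] meets the
    boundary, at the supremum of the parameters of its points in [Om]. *)
Lemma boundary_hitP x y : Om x -> ~ ray x y `<=` Om ->
  (ray x y `&` (closure Om `\` Om)) (boundary_hit Om x y).
Proof.
move=> Ox /existsNP[_ /not_implyP[[t0 /= t00 <-] nO0]].
have [_ oOm _ _ _] := sOm.
pose f t := x + t *: (y - x).
pose S := [set t : R | 0 <= t /\ Om (f t)].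
have S0 : S 0 by rewrite /S /f/= scale0r addr0.
have ubS : ubound S t0.
  move=> t [tge0 Ot]; rewrite leNgt; apply/negP => ltt; apply: nO0.
  have tgt0 : 0 < t by exact: le_lt_trans ltt.
  have -> : x + t0 *: (y - x) = (t0 / t) *: f t + (1 - t0 / t) *: x.
    rewrite /f [in RHS]scalerDr scalerA divfK ?gt_eqF// scalerBl scale1r.
    by rewrite [RHS]addrAC [in RHS]addrCA subrr addr0.
  by apply: domain_convex => //; rewrite divr_ge0//= ler_pdivrMr// mul1r ltW.
have hsS : has_sup S by split; [exists 0|exists t0].
have T0 : 0 <= sup S by exact: ub_le_sup hsS.2 _ S0.
have cf : f @ sup S --> f (sup S).
  exact (cvgD (cvg_cst x) (cvgZr_tmp (a := y - x) cvg_id)).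
suff ex : exists z, (ray x y `&` (closure Om `\` Om)) z by exact: (xgetPex 0 ex).
exists (f (sup S)); split; first by exists (sup S).
split.
  move=> B /cf /nbhs_ballP[e /= e0 eB].
  have [t St tS] := sup_adherent e0 hsS.
  exists (f t); split; first by case: St.
  apply: eB; rewrite /ball/= ger0_norm ?subr_ge0; first by rewrite ltrBlDr addrC -ltrBlDr.
  exact: ub_le_sup hsS.2 _ St.
move=> OT.
have /nbhs_ballP[e /= e0 eO] := cf _ (open_nbhs_nbhs (conj oOm OT)).
have : S (sup S + e / 2).
  split; first by rewrite addr_ge0// divr_ge0// ltW.
  apply: eO; rewrite /ball/= opprD addrA subrr add0r normrN gtr0_norm; lra.
by move/(ub_le_sup hsS.2); apply/negP; rewrite -ltNge ltrDl; lra.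
Qed.

Lemma funkxx x : funk Om x x = 0.
Proof. by rewrite /funk eqxx. Qed.

(** [exp (- F(x, y))]; for [x] and [y] in [Om], the largest [s] such that
    [hom y - s hom x] lies in the closed cone. *)
Definition exit_scale x y : R := expR (- funk Om x y).

(** The lift to the closed cone of the exit point of the ray from [x] through
    [y], for distinct [x] and [y] in [Om]; it is 0 when [x = y]. *)
Definition exit_vec x y : 'rV[R]_(1 + n) := hom y - exit_scale x y *: hom x.

Lemma exit_scale_gt0 x y : 0 < exit_scale x y.
Proof. exact: expR_gt0. Qed.

Lemma exit_scalexx x : exit_scale x x = 1.
Proof. by rewrite /exit_scale funkxx oppr0 expR0. Qed.

Lemma exit_vecxx x : exit_vec x x = 0.
Proof. by rewrite /exit_vec exit_scalexx scale1r subrr. Qed.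

Lemma exit_vecP x y : Om x -> Om y ->
  [/\ closed_cone Om (exit_vec x y), ~ open_cone (exit_vec x y) &
     x != y -> ray_end Om x y = proj (exit_vec x y)].
Proof.
move=> Ox Oy; have [->|xy] := eqVneq x y.
  rewrite exit_vecxx; split=> //; first exact: closed_cone0.
  by move=> /open_cone_neq0; rewrite eqxx.
have yx0 : y - x != 0 by rewrite subr_eq0 eq_sym.
have [rO|nrO] := pselect (ray x y `<=` Om).
  have rE : ray_end Om x y = point_at_infinity (y - x).
    by rewrite /ray_end asboolT.
  have vE : exit_vec x y = row_mx 0 (y - x).
    rewrite /exit_vec /exit_scale /funk rE asboolT ?orbT; last exact: point_at_infinityP.
    by rewrite oppr0 expR0 scale1r /hom opp_row_mx add_row_mx subrr.
  rewrite vE rE; split=> //; last by rewrite open_coneP row_mxKl mxE ltxx => -[].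
  apply: (closed_cone_approx (c := hom x)) => e e0.
  have -> : e *: hom x + row_mx 0 (y - x) = e *: hom (x + e^-1 *: (y - x)).
    rewrite /hom !scale_row_mx add_row_mx addr0; congr row_mx.
    by rewrite scalerDr scalerA mulfV ?gt_eqF// scale1r.
  apply: open_coneZ => //; apply/open_cone_hom/rO.
  by exists e^-1 => //=; rewrite invr_ge0 ltW.
have rE : ray_end Om x y = affine_point (boundary_hit Om x y).
  by rewrite /ray_end asboolF.
have [[t /= t0 zE] [clz nOz]] := boundary_hitP Ox nrO.
set z := boundary_hit Om x y in rE zE clz nOz.
have t1 : 1 < t.
  rewrite ltNge; apply/negP => t1; apply: nOz; rewrite -zE.
  have -> : x + t *: (y - x) = t *: y + (1 - t) *: x.
    by rewrite scalerBr scalerBl scale1r addrCA.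
  by apply: domain_convex => //; rewrite t0.
have tgt0 : 0 < t by exact: lt_trans t1.
have mE : exit_scale x y = (t - 1) / t.
  rewrite /exit_scale /funk rE (negbTE xy)/= asboolF; last by apply; exists z.
  rewrite affine_coordK -zE.
  have -> : x - (x + t *: (y - x)) = (- t) *: (y - x).
    by rewrite opprD addrA subrr add0r scaleNr.
  have -> : y - (x + t *: (y - x)) = (1 - t) *: (y - x).
    by rewrite opprD addrA scalerBl scale1r.
  have N0 := euclidean_norm_gt0 yx0.
  rewrite !euclidean_normZ normrN gtr0_norm// ltr0_norm ?subr_lt0// opprB.
  rewrite expRN lnK ?posrE ?divr_gt0 ?mulr_gt0 ?subr_gt0//.
  by field; rewrite !gt_eqF ?subr_gt0.
have vE : exit_vec x y = t^-1 *: hom z.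
  rewrite /exit_vec mE /hom -zE !scale_row_mx opp_row_mx add_row_mx; congr row_mx.
    by apply/matrixP => i j; rewrite !mxE; field; rewrite gt_eqF.
  by apply/matrixP => i j; rewrite !mxE; field; rewrite gt_eqF.
rewrite vE; split.
- by apply: closed_coneZ; rewrite ?invr_ge0 ?ltW//; exact: closed_cone_hom_closure.
- move=> /(open_coneZ tgt0); rewrite scalerA mulfV ?gt_eqF// scale1r.
  by move/open_cone_hom.
- by move=> _; rewrite rE proj_scale ?invr_eq0 ?gt_eqF// row_mx1_neq0.
Qed.

Lemma exit_scale_max x z (s : R) : Om x -> Om z ->
  closed_cone Om (hom z - s *: hom x) -> s <= exit_scale x z.
Proof.
move=> Ox Oz Ks; rewrite leNgt; apply/negP => lts.
have [_ nC _] := exit_vecP Ox Oz; apply: nC.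
have -> : exit_vec x z = (s - exit_scale x z) *: hom x + (hom z - s *: hom x).
  by rewrite /exit_vec scalerBl [RHS]addrC addrA subrK.
apply: open_closed_coneD => //; apply: open_coneZ; first by rewrite subr_gt0.
exact/open_cone_hom.
Qed.

Lemma exit_scale_min x z (s : R) : Om x -> Om z ->
  ~ open_cone (hom z - s *: hom x) -> exit_scale x z <= s.
Proof.
move=> Ox Oz nC; rewrite leNgt; apply/negP => lts; apply: nC.
have [Kv _ _] := exit_vecP Ox Oz.
have -> : hom z - s *: hom x = (exit_scale x z - s) *: hom x + exit_vec x z.
  by rewrite /exit_vec scalerBl [RHS]addrC addrA subrK.
apply: open_closed_coneD => //; apply: open_coneZ; first by rewrite subr_gt0.
exact/open_cone_hom.
Qed.

Lemma exit_vec_neq0 x y : x != y -> exit_vec x y != 0.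
Proof.
apply: contra; rewrite subr_eq0 /hom scale_row_mx => /eqP/eq_row_mx[e1 e2].
have := e1 => /matrixP/(_ 0 0); rewrite !mxE/= mulr1 => m1.
by rewrite e2 -m1 scale1r.
Qed.

Lemma exit_vec_comp x y z :
  exit_vec y z + exit_scale y z *: exit_vec x y =
  hom z - (exit_scale y z * exit_scale x y) *: hom x.
Proof. by rewrite /exit_vec scalerBr scalerA addrA subrK. Qed.

Lemma funk_triangle x y z : Om x -> Om y -> Om z ->
  funk Om x z <= funk Om x y + funk Om y z.
Proof.
move=> Ox Oy Oz; have [Kxy _ _] := exit_vecP Ox Oy.
have [Kyz _ _] := exit_vecP Oy Oz.
rewrite -lerN2 -ler_expR opprD addrC expRD; apply: (exit_scale_max Ox Oz).
rewrite -exit_vec_comp; apply: (closed_coneD Kyz).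
by apply: (closed_coneZ _ Kxy); rewrite ltW// exit_scale_gt0.
Qed.

Lemma funk_additive x y z : Om x -> Om y -> Om z ->
  ~ open_cone (exit_vec y z + exit_scale y z *: exit_vec x y) ->
  funk Om x z = funk Om x y + funk Om y z.
Proof.
move=> Ox Oy Oz nC; apply/eqP; rewrite eq_le funk_triangle//=.
rewrite -lerN2 -ler_expR opprD addrC expRD; apply: exit_scale_min => //.
by rewrite -exit_vec_comp.
Qed.

(** The lift of the exit point is additive, up to positive factors, along a
    chain on which the triangle inequality is an equality. *)
Lemma exit_vec_additive x y z : funk Om x z = funk Om x y + funk Om y z ->
  exit_vec x z = exit_vec y z + exit_scale y z *: exit_vec x y.
Proof.
move=> e; rewrite exit_vec_comp /exit_vec; congr (_ - _ *: _).
by rewrite /exit_scale e opprD addrC expRD.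
Qed.

(** * Faces *)

(** The face of the cone [closed_cone Om] generated by [a]: the vectors
    dominated by a multiple of [a] in the order defined by the cone. *)
Definition face_cone (a : 'rV[R]_(1 + n)) : set 'rV[R]_(1 + n) :=
  [set u | closed_cone Om u /\
    exists2 s : R, 0 <= s & closed_cone Om (s *: a - u)].

(** The set of projective points with a nonzero lift in [face_cone a]. *)
Definition face_of (a : 'rV[R]_(1 + n)) : set (projective_space R n) :=
  @Defs.proj R n @` [set u | face_cone a u /\ u != 0].

Lemma face_cone_self a : closed_cone Om a -> face_cone a a.
Proof.
by split => //; exists 1; rewrite // scale1r subrr; exact: closed_cone0.
Qed.

Lemma face_coneD a u v : face_cone a u -> face_cone a v -> face_cone a (u + v).
Proof.
move=> [Ku [s s0 Ks]] [Kv [t t0 Kt]]; split; first exact: closed_coneD Ku Kv.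
exists (s + t); first exact: addr_ge0.
by rewrite scalerDl opprD addrACA; exact: closed_coneD Ks Kt.
Qed.

Lemma face_coneZ a (t : R) u : 0 <= t -> face_cone a u -> face_cone a (t *: u).
Proof.
move=> t0 [Ku [s s0 Ks]]; split; first exact: closed_coneZ t0 Ku.
exists (t * s); first exact: mulr_ge0.
by rewrite -scalerA -scalerBr; exact: closed_coneZ t0 Ks.
Qed.

Lemma face_coneZ_inv a (t : R) u : 0 < t ->
  face_cone a (t *: u) -> face_cone a u.
Proof.
move=> t0 /(@face_coneZ _ t^-1); rewrite scalerA mulVf ?gt_eqF// scale1r.
by apply; rewrite invr_ge0 ltW.
Qed.

Lemma face_coneDl a u v : closed_cone Om u -> closed_cone Om v ->
  face_cone a (u + v) -> face_cone a u.
Proof.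
move=> Ku Kv [_ [s s0 Ks]]; split; first exact: Ku.
exists s; first exact: s0.
have -> : s *: a - u = (s *: a - (u + v)) + v by rewrite opprD addrA subrK.
exact: closed_coneD Ks Kv.
Qed.

Lemma face_coneDr a u v : closed_cone Om u -> closed_cone Om v ->
  face_cone a (u + v) -> face_cone a v.
Proof. by move=> Ku Kv; rewrite addrC; exact: face_coneDl Kv Ku. Qed.

Lemma closed_cone_comb_neq0 u v (t : R) : closed_cone Om u -> closed_cone Om v ->
  u != 0 -> v != 0 -> 0 <= t <= 1 -> (1 - t) *: u + t *: v != 0.
Proof.
move=> Ku Kv u0 v0 /andP[t0 t1]; apply/eqP => e.
have K1 : closed_cone Om ((1 - t) *: u) by apply: (closed_coneZ _ Ku); rewrite subr_ge0.
have K2 := closed_coneZ t0 Kv.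
have /eqP := closed_coneD_eq0 K1 K2 e; rewrite scaler_eq0 (negbTE u0) orbF subr_eq0.
move=> /eqP t1'; have := closed_coneD_eq0 K2 K1; rewrite addrC e => /(_ erefl)/eqP.
by rewrite -t1' scale1r; exact/negP.
Qed.

(** Two lifts of a point to the closed cone differ by a positive factor. *)
Lemma proj_eq_pos u v : closed_cone Om u -> closed_cone Om v ->
  u != 0 -> v != 0 -> proj u = proj v -> exists2 s : R, 0 < s & u = s *: v.
Proof.
move=> Ku Kv u0 v0 /(projP u0 v0)[s _ uE]; exists s => //.
by apply: (closed_coneZ_gt0 v0 Kv); rewrite -uE.
Qed.

Lemma face_of_lift a u : closed_cone Om u -> u != 0 ->
  face_of a (proj u) -> face_cone a u.
Proof.
move=> Ku u0 [v [[Kv Fv] v0] /esym/(proj_eq_pos Ku Kv u0 v0)[s s0 ->]].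
by apply: (face_coneZ (ltW s0)); split.
Qed.

Lemma affine_point_open_cone u :
  open_cone u -> (@affine_point R n @` Om) (proj u).
Proof.
move=> [s /= s0 [x Ox <-]]; exists x => //.
by rewrite proj_scale ?gt_eqF// row_mx1_neq0.
Qed.

Lemma open_cone_affine_point u : closed_cone Om u -> u != 0 ->
  (@affine_point R n @` Om) (proj u) -> open_cone u.
Proof.
move=> Ku u0 [x /open_cone_hom Cx /esym e].
have [s s0 ->] := proj_eq_pos Ku (open_cone_closed Cx) u0 (row_mx1_neq0 x) e.
exact: open_coneZ.
Qed.

Lemma proj_closed_cone u : closed_cone Om u -> u != 0 ->
  proj_closure Om (proj u).
Proof.
move=> Ku u0.
have C0 : open_cone `<=` [set w | w != 0] by move=> w; exact: open_cone_neq0.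
apply: closure_subset (proj_closure_of u0 C0 Ku).
by move=> _ [w Cw <-]; exact: affine_point_open_cone.
Qed.

Lemma face_of_face a : proj_face Om (face_of a).
Proof.
have seg u v (t : R) : face_cone a u -> face_cone a v -> u != 0 -> v != 0 ->
    0 <= t <= 1 -> face_of a (proj ((1 - t) *: u + t *: v)).
  move=> Fu Fv u0 v0 t01; have [Ku _] := Fu; have [Kv _] := Fv.
  exists ((1 - t) *: u + t *: v); last by [].
  split; last exact: closed_cone_comb_neq0 Ku Kv u0 v0 t01.
  have /andP[t0 t1] := t01; have s0 : 0 <= 1 - t by rewrite subr_ge0.
  exact: face_coneD (face_coneZ s0 Fu) (face_coneZ t0 Fv).
split.
- by move=> _ [u [[Ku _] u0] <-]; exact: proj_closed_cone.
- move=> x y Dx Dy z [u [v [t [[Ku u0 ux] [Kv v0 vy] t01 ->]]]].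
  rewrite -ux in Dx; rewrite -vy in Dy.
  exact: seg (face_of_lift Ku u0 Dx) (face_of_lift Kv v0 Dy) u0 v0 t01.
- move=> x y _ _ [z [[u [v [t [[Ku u0 ux] [Kv v0 vy] /andP[t0 t1] zE]]]] Dz]].
  have t01 : 0 <= t <= 1 by rewrite !ltW.
  have s0 : 0 < 1 - t by rewrite subr_gt0.
  have Ku' := closed_coneZ (ltW s0) Ku; have Kv' := closed_coneZ (ltW t0) Kv.
  have Fuv : face_cone a ((1 - t) *: u + t *: v).
    rewrite zE in Dz.
    exact: face_of_lift (closed_coneD Ku' Kv')
      (closed_cone_comb_neq0 Ku Kv u0 v0 t01) Dz.
  have Fu := face_coneZ_inv s0 (face_coneDl Ku' Kv' Fuv).
  have Fv := face_coneZ_inv t0 (face_coneDr Ku' Kv' Fuv).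
  move=> _ [u1 [v1 [t1' [[Ku1 u10 u1x] [Kv1 v10 v1y] t1'01 ->]]]].
  have Du : face_of a (proj u1) by rewrite u1x -ux; exists u.
  have Dv : face_of a (proj v1) by rewrite v1y -vy; exists v.
  exact: seg (face_of_lift Ku1 u10 Du) (face_of_lift Kv1 v10 Dv) u10 v10 t1'01.
Qed.

Lemma face_of_boundary a : closed_cone Om a -> ~ open_cone a ->
  face_of a `<=` proj_boundary Om.
Proof.
move=> Ka nCa _ [u [[Ku [s s0 Ks]] u0] <-]; split; first exact: proj_closed_cone.
move=> /(open_cone_affine_point Ku u0)/open_closed_coneD/(_ Ks).
rewrite addrC subrK.
move: s0; rewrite le_eqVlt => /predU1P[<-|s0].
  by rewrite scale0r => /open_cone_neq0; rewrite eqxx.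
have si0 : 0 < s^-1 by rewrite invr_gt0.
by move=> /(open_coneZ si0); rewrite scalerA mulVf ?gt_eqF// scale1r.
Qed.

(** If the Funk distance is additive along [x, y, z, w], the exit point of the
    ray from [y] through [z] lies in the face generated by the exit point of the
    ray from [x] through [w]. *)
Lemma face_of_ray_end x y z (w : 'rV[R]_n) : Om x -> Om y -> Om z -> Om w -> y != z ->
  funk Om x w = funk Om x y + funk Om y z + funk Om z w ->
  face_of (exit_vec x w) (ray_end Om y z).
Proof.
move=> Ox Oy Oz Ow yz e.
have [exz exw] :=
  chain_additive (funk_triangle Ox Oy Oz) (funk_triangle Ox Oz Ow) e.
have [Kxw _ _] := exit_vecP Ox Ow; have [Kzw _ _] := exit_vecP Oz Ow.
have [Kxz _ _] := exit_vecP Ox Oz; have [Kxy _ _] := exit_vecP Ox Oy.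
have [Kyz _ rE] := exit_vecP Oy Oz.
rewrite (rE yz); exists (exit_vec y z); last by [].
split; last exact: exit_vec_neq0.
have := face_cone_self Kxw; rewrite {2}(exit_vec_additive exw).
have Kxz' := closed_coneZ (ltW (exit_scale_gt0 z w)) Kxz.
move=> /(face_coneDr Kzw Kxz')/(face_coneZ_inv (exit_scale_gt0 z w)).
rewrite (exit_vec_additive exz); apply: (face_coneDl Kyz).
exact: closed_coneZ (ltW (exit_scale_gt0 y z)) Kxy.
Qed.

Lemma face_funk_additive D x y z : Om x -> Om y -> Om z ->
  proj_convex Om D -> D `<=` proj_boundary Om ->
  (x != y -> D (ray_end Om x y)) -> (y != z -> D (ray_end Om y z)) ->
  funk Om x z = funk Om x y + funk Om y z.
Proof.
move=> Ox Oy Oz cD Db Dxy Dyz.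
have [->|xy] := eqVneq x y; first by rewrite funkxx add0r.
have [<-|yz] := eqVneq y z; first by rewrite funkxx addr0.
have [Kxy _ /(_ xy) rxy] := exit_vecP Ox Oy.
have [Kyz _ /(_ yz) ryz] := exit_vecP Oy Oz.
apply: funk_additive => //; set m := exit_scale y z => CS.
have m0 : 0 < m := exit_scale_gt0 y z.
have m1 : 0 < 1 + m := addr_gt0 ltr01 m0.
(* the combination of the two lifts, scaled to have coefficients of sum 1 *)
pose t := m / (1 + m).
have t01 : 0 <= t <= 1.
  by rewrite divr_ge0 ?(ltW m0) ?(ltW m1)//= ler_pdivrMr// mul1r lerDr.
have wE : (1 + m)^-1 *: (exit_vec y z + m *: exit_vec x y) =
    (1 - t) *: exit_vec y z + t *: exit_vec x y.
  rewrite scalerDr scalerA; congr (_ *: _ + _ *: _); rewrite /t.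
    exact: invD_compl.
  by rewrite mulrC.
have : D (proj ((1 - t) *: exit_vec y z + t *: exit_vec x y)).
  apply: (cD _ _ (Dyz yz) (Dxy xy)).
  exists (exit_vec y z), (exit_vec x y), t; split=> //.
    by split; rewrite ?exit_vec_neq0.
  by split; rewrite ?exit_vec_neq0.
move=> /Db[_]; apply; apply: affine_point_open_cone.
by rewrite -wE; apply: open_coneZ => //; rewrite invr_gt0.
Qed.

(** * Geodesics of the Hilbert metric *)

Lemma hilbertxx x : hilbert Om x x = 0.
Proof. by rewrite /hilbert funkxx addr0 mulr0. Qed.

Lemma funk_chain_le x y z (w : 'rV[R]_n) : Om x -> Om y -> Om z -> Om w ->
  funk Om x w <= funk Om x y + funk Om y z + funk Om z w.
Proof.
move=> Ox Oy Oz Ow; apply: le_trans (funk_triangle Ox Oz Ow) _.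
by rewrite lerD2r; exact: funk_triangle.
Qed.

(** The Hilbert distance is additive along a chain only if the Funk distance is
    additive along the chain and along the reversed chain. *)
Lemma hilbert_chain_funk x y z (w : 'rV[R]_n) : Om x -> Om y -> Om z -> Om w ->
  hilbert Om x y + hilbert Om y z + hilbert Om z w <= hilbert Om x w ->
  funk Om x w = funk Om x y + funk Om y z + funk Om z w /\
  funk Om w x = funk Om w z + funk Om z y + funk Om y x.
Proof.
move=> Ox Oy Oz Ow.
exact: halves_additive (funk_chain_le Ox Oy Oz Ow) (funk_chain_le Ow Oz Oy Ox).
Qed.

Lemma hilbert_additive x y z :
  funk Om x z = funk Om x y + funk Om y z ->
  funk Om z x = funk Om z y + funk Om y x ->
  hilbert Om x z = hilbert Om x y + hilbert Om y z.
Proof. exact: halves_sum. Qed.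

Lemma hilbert_sum_nil (a b : R) (g : R -> 'rV[R]_n) :
  hilbert_sum Om a b g [::] = 0.
Proof. by rewrite /hilbert_sum /= big_geq. Qed.

Lemma hilbert_sum_cons (a b c : R) (g : R -> 'rV[R]_n) (s : seq R) :
  hilbert_sum Om a b g (c :: s) =
  hilbert Om (g a) (g c) + hilbert_sum Om c b g s.
Proof. by rewrite /hilbert_sum /= big_nat_recl. Qed.

Lemma hilbert_sum_le_length (a b : R) (g : R -> 'rV[R]_n) (s : seq R) :
  itv_partition a b s ->
  ((hilbert_sum Om a b g s)%:E <= hilbert_length Om a b g)%E.
Proof. by move=> abs; apply: ereal_sup_ubound; exists s. Qed.

Lemma hilbert_sum1 (a b : R) (g : R -> 'rV[R]_n) :
  hilbert_sum Om a b g [:: b] = hilbert Om (g a) (g b).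
Proof. by rewrite hilbert_sum_cons hilbert_sum_nil (addr0 (hilbert _ _ _)). Qed.

Lemma hilbert_geodesic_chain (a b s t : R) (g : R -> 'rV[R]_n) :
  hilbert_geodesic Om a b g -> a <= s -> s < t -> t <= b ->
  hilbert Om (g a) (g s) + hilbert Om (g s) (g t) + hilbert Om (g t) (g b) <=
  hilbert Om (g a) (g b).
Proof.
move=> geo les lst let_.
have sum_le (p : seq R) : itv_partition a b p ->
    hilbert_sum Om a b g p <= hilbert Om (g a) (g b).
  by move=> /(hilbert_sum_le_length g); rewrite -geo lee_fin.
(* the subdivision a <= s < t <= b, with repeated points removed *)
move: les; rewrite le_eqVlt => /predU1P[as_|as_];
  move: let_; rewrite le_eqVlt => /predU1P[tb|tb].
- by rewrite as_ tb !hilbertxx add0r addr0.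
- have := sum_le [:: t; b].
  rewrite hilbert_sum_cons hilbert_sum1 as_ hilbertxx add0r; apply.
  by rewrite /itv_partition /= lst tb.
- have := sum_le [:: s; b].
  rewrite hilbert_sum_cons hilbert_sum1 tb hilbertxx.
  rewrite (addr0 (hilbert _ _ _ + _)); apply.
  by rewrite /itv_partition /= as_ -tb lst.
- have := sum_le [:: s; t; b].
  rewrite !(hilbert_sum_cons _ b _ g [:: _ & _]) hilbert_sum1 addrA; apply.
  by rewrite /itv_partition /= as_ lst tb.
Qed.

Lemma hilbert_sum_additive (a0 a b : R) (g : R -> 'rV[R]_n) (s : seq R) :
  (forall t1 t2 t3, a0 <= t1 -> t1 < t2 -> t2 <= t3 -> t3 <= b ->
    hilbert Om (g t1) (g t3) = hilbert Om (g t1) (g t2) + hilbert Om (g t2) (g t3)) ->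
  a0 <= a -> itv_partition a b s ->
  hilbert_sum Om a b g s = hilbert Om (g a) (g b).
Proof.
move=> add; elim: s a => [|c s IHs] a a0a abs.
  by rewrite (itv_partition_nil abs) hilbert_sum_nil hilbertxx.
have cbs := itv_partition_cons abs.
have ac : a < c by case: abs => /= /andP[].
rewrite hilbert_sum_cons IHs//; last by rewrite (le_trans a0a)// ltW.
by rewrite -add// (itv_partition_le cbs).
Qed.

Lemma hilbert_geodesicP (a b : R) (g : R -> 'rV[R]_n) : a < b ->
  (forall t1 t2 t3, a <= t1 -> t1 < t2 -> t2 <= t3 -> t3 <= b ->
    hilbert Om (g t1) (g t3) = hilbert Om (g t1) (g t2) + hilbert Om (g t2) (g t3)) ->
  hilbert_geodesic Om a b g.
Proof.
move=> ab add; rewrite /hilbert_geodesic /hilbert_length.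
rewrite (_ : [set _ | _ in _] = [set (hilbert Om (g a) (g b))%:E]) ?ereal_sup1//.
apply/seteqP; split=> [_ [s abs <-]|_ ->] /=.
  by rewrite (hilbert_sum_additive add (lexx a) abs).
exists [:: b]; first exact: itv_partition1.
by rewrite hilbert_sum1.
Qed.

End Cone.

Theorem theorem12p5 (R : realType) (n : nat) (Om : set 'rV[R]_n)
    (g : R -> 'rV[R]_n) :
  sharp_convex_domain Om ->
  path_in Om 0 1 g ->
  hilbert_geodesic Om 0 1 g <->
  exists Dminus Dplus : set (projective_space R n),
    [/\ proj_face Om Dminus, Dminus `<=` proj_boundary Om,
        proj_face Om Dplus, Dplus `<=` proj_boundary Om
      & forall t1 t2 : R, t1 \in `[0, 1] -> t2 \in `[0, 1] -> t1 < t2 ->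
          cone_over Om (g t1) Dplus (g t2 - g t1) /\
          cone_over Om (g t2) Dminus (g t1 - g t2)].
Proof.
move=> sOm [_ Og].
have O0 : Om (g 0) by apply: Og; rewrite in_itv/= lexx ler01.
have O1 : Om (g 1) by apply: Og; rewrite in_itv/= lexx ler01.
split=> [geo|[Dm [Dp [fm bm fp bp H]]]].
- have [K10 nC10 _] := exit_vecP sOm O1 O0.
  have [K01 nC01 _] := exit_vecP sOm O0 O1.
  exists (face_of Om (exit_vec Om (g 1) (g 0))),
    (face_of Om (exit_vec Om (g 0) (g 1))); split.
  + exact: face_of_face.
  + exact: face_of_boundary.
  + exact: face_of_face.
  + exact: face_of_boundary.
  move=> s t s01 t01 st; have Os := Og _ s01; have Ot := Og _ t01.
  move: s01 t01; rewrite !in_itv/= => /andP[s0 _] /andP[_ t1].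
  have [e e'] := hilbert_chain_funk sOm O0 Os Ot O1
    (hilbert_geodesic_chain geo s0 st t1).
  rewrite /cone_over/= !subrKC.
  have [->|gst] := eqVneq (g s) (g t); first by rewrite subrr; split; left.
  split; right; first exact: (face_of_ray_end sOm O0 Os Ot O1 gst e).
  by apply: (face_of_ray_end sOm O1 Ot Os O0 _ e'); rewrite eq_sym.
- apply: hilbert_geodesicP => // t1 t2 t3 t10 t12.
  rewrite le_eqVlt => /predU1P[->|t23] t31.
    by rewrite hilbertxx (addr0 (hilbert _ _ _)).
  have t1I : t1 \in `[0, 1].
    by rewrite in_itv/= t10 (le_trans (ltW t12))// (le_trans (ltW t23)).
  have t2I : t2 \in `[0, 1].
    by rewrite in_itv/= (le_trans t10 (ltW t12)) (le_trans (ltW t23)).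
  have t3I : t3 \in `[0, 1].
    by rewrite in_itv/= t31 andbT (le_trans t10)// ltW// (lt_trans t12).
  have [Op1 Op2 Op3] := And3 (Og _ t1I) (Og _ t2I) (Og _ t3I).
  have ends (D : set (projective_space R n)) (x y : 'rV[R]_n) :
      cone_over Om x D (y - x) -> x != y -> D (ray_end Om x y).
    move=> [/eqP|]; last by rewrite subrKC.
    by rewrite subr_eq0 eq_sym => /eqP -> /eqP.
  have [/ends p12 /ends m21] := H _ _ t1I t2I t12.
  have [/ends p23 /ends m32] := H _ _ t2I t3I t23.
  have [_ cp _] := fp; have [_ cm _] := fm.
  apply: hilbert_additive.
  + exact: (face_funk_additive sOm Op1 Op2 Op3 cp bp p12 p23).
  + exact: (face_funk_additive sOm Op3 Op2 Op1 cm bm m32 m21).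
Qed.
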